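(* Let $A$ and $B$ be disjoint finite sets of points in the plane with $|A|=|B|=n$ such that $A\cup B$ is not collinear. Then the bivisibility graph $\mathcal{B}(A,B)$ contains a non-crossing subgraph with at least $n+1$ edges.
   Context: For disjoint finite point sets $A,B$ in the plane, the bivisibility graph $\mathcal{B}(A,B)$ has vertex set $A\cup B$, where $v\in A$ and $w\in B$ are adjacent iff no point of $A\cup B$ lies in the open segment $vw$. Edges are drawn as straight segments; a subgraph is non-crossing if no two of its edges intersect except at a common endpoint. *)

(* Defs.v *)
From HB Require Import structures.
From mathcomp Require Import all_boot all_order all_algebra.
From mathcomp Require Import finmap.
From mathcomp Require Import reals.

Set Implicit Arguments.
Unset Strict Implicit.
Unset Printing Implicit Defensive.

Import Order.TTheory GRing.Theory Num.Theory.

Local Open Scope ring_scope.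

Definition in_open_segment (R : realType) (v w x : 'rV[R]_2) : Prop :=
  exists2 t : R, 0 < t < 1 & x = (1 - t) *: v + t *: w.

Definition in_closed_segment (R : realType) (v w x : 'rV[R]_2) : Prop :=
  exists2 t : R, 0 <= t <= 1 & x = (1 - t) *: v + t *: w.

Definition collinear (R : realType) (S : {fset 'rV[R]_2}) : Prop :=
  exists p d : 'rV[R]_2,
    d != 0 /\ forall x, x \in S -> exists t : R, x = p + t *: d.

(* The graph is bipartite with disjoint parts A and B, so an (undirected) edge
   is represented by the unique ordered pair (v, w) listing its endpoint v in A
   first and its endpoint w in B second. *)
Definition bivisibility_edge (R : realType) (A B : {fset 'rV[R]_2})
    (e : 'rV[R]_2 * 'rV[R]_2) : Prop :=
  [/\ e.1 \in A, e.2 \in B &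
      forall x, x \in (A `|` B)%fset -> ~ in_open_segment e.1 e.2 x].

(* A subgraph is given by its edge set; isolated vertices are irrelevant. *)
Definition bivisibility_subgraph (R : realType) (A B : {fset 'rV[R]_2})
    (E : {fset 'rV[R]_2 * 'rV[R]_2}) : Prop :=
  forall e, e \in E -> bivisibility_edge A B e.

Definition endpoint (R : realType) (e : 'rV[R]_2 * 'rV[R]_2) (x : 'rV[R]_2) :
    Prop :=
  x = e.1 \/ x = e.2.

Definition non_crossing (R : realType) (E : {fset 'rV[R]_2 * 'rV[R]_2}) :
    Prop :=
  forall e f, e \in E -> f \in E -> e <> f ->
  forall x, in_closed_segment e.1 e.2 x -> in_closed_segment f.1 f.2 x ->
    endpoint e x /\ endpoint f x.

(* Main.v *)
Require Import Defs.
From mathcomp Require Import all_boot all_order all_algebra.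
From mathcomp Require Import finmap.
From mathcomp Require Import reals.
From mathcomp Require Import boolp.
From mathcomp Require Import ring lra zify.

(** By induction on [n], it suffices to split the point set [P] by a line into
    two nonempty parts with as many points of [A] as of [B] each.

    Existence of the split. Order [P] so that every prefix can be cut off by a
    line. If no proper prefix is balanced, the prefix excesses [#A - #B] keep
    the sign of the first point, and the last point has the other colour. Apply
    this to the angular order around a corner [v] of the hull, [v] coming last:
    the next corner [p] has the colour opposite to [v]. Now sweep [P] parallel
    to the hull edge [vp], reading each parallel line from [v] to [p] or from
    [p] to [v]. Both orders have the points on [vp] as a prefix, whose excess
    would have the sign of [v] and that of [p].

    Gluing. If both parts are non-collinear, induction gives [n + 2] edges. If a
    part [Q] with [2m] points lies on a line not containing the other part [X],
    some [p] in [X] sees all of [Q] from outside the hull of [X], which gives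
    [m] edges, and [Q] has at least one edge of its own. If both parts are
    collinear, take such a [p] in the second one; after joining it to the first
    part, a point of the first part is joined in the same way to the rest of
    the second. *)

Import Order.TTheory GRing.Theory Num.Theory.

Set Implicit Arguments.
Unset Strict Implicit.
Unset Printing Implicit Defensive.

Local Open Scope ring_scope.

(** * Affine functions, separation by perturbed lines, and collinearity *)

Section AffineFunctions.
Variable R : realType.
Implicit Types (x y v w : 'rV[R]_2) (f g h u : 'rV[R]_2 -> R).

Definition affine f :=
  exists a b c : R, forall x, f x = a * x 0 0 + b * x 0 1 + c.

Lemma affine_comb f g (a b c : R) :
  affine f -> affine g -> affine (fun x => a * f x + b * g x + c).
Proof.
move=> [a1 [b1 [c1 Ef]]] [a2 [b2 [c2 Eg]]].
exists (a * a1 + b * a2), (a * b1 + b * b2), (a * c1 + b * c2 + c) => x.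
by rewrite Ef Eg; ring.
Qed.

Lemma affine_opp f : affine f -> affine (fun x => - f x).
Proof.
move=> [a [b [c Ef]]]; exists (- a), (- b), (- c) => x.
by rewrite Ef; ring.
Qed.

Lemma affine_segment f v w (t : R) :
  affine f -> f ((1 - t) *: v + t *: w) = (1 - t) * f v + t * f w.
Proof.
move=> [a [b [c Ef]]]; rewrite !Ef !mxE; ring.
Qed.

Lemma rV2P x y : x 0 0 = y 0 0 -> x 0 1 = y 0 1 -> x = y.
Proof.
move=> e0 e1; apply/rowP => i.
by case: (splitP (i : 'I_(1 + 1))) => j Ej; [have -> : i = 0 | have -> : i = 1];
  rewrite // ; apply: val_inj; rewrite /= Ej ord1.
Qed.

(** On a finite list, a small enough [e] keeps [e * g] below every nonzero [|f|]; zeros of [f]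
    impose nothing. The induction runs on the stronger claim for all [e] up to a bound, so that
    bounds combine by minimum. *)
Lemma small_perturbation (T : eqType) (s : seq T) (f g : T -> R) :
  exists2 e : R, 0 < e & forall x : T, x \in s ->
    (0 < f x -> 0 < f x + e * g x) /\ (f x < 0 -> f x + e * g x < 0).
Proof.
suff [e e0 He] : exists2 e0 : R, 0 < e0 & forall e, 0 < e <= e0 ->
    forall x : T, x \in s ->
    (0 < f x -> 0 < f x + e * g x) /\ (f x < 0 -> f x + e * g x < 0).
  by exists e => // x xs; apply: He => //; rewrite e0 lexx.
elim: s => [|y s [e0 e0_gt0 IH]]; first by exists 1.
(* If [f y = 0], any positive bound will do. Otherwise the half turns the weak bound on [e] into the
   strict [|e * g y| < |f y|], and the [1 +] avoids division by zero. *)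
pose d := if f y == 0 then 1 else `|f y| / (1 + `|g y|) / 2.
have g1 : 0 < 1 + `|g y| by have := normr_ge0 (g y); lra.
have d_gt0 : 0 < d.
  by rewrite /d; case: eqP => // /eqP fy; rewrite !divr_gt0 ?normr_gt0.
exists (Num.min e0 d); first by rewrite lt_min e0_gt0.
move=> e /andP[e_gt0]; rewrite le_min => /andP[le_e le_d] x.
rewrite inE => /predU1P[->|xs]; last by apply: IH => //; rewrite e_gt0.
have [fy0|fy] := eqVneq (f y) 0; first by rewrite fy0 ltxx.
have Hb : `|e * g y| < `|f y|.
  rewrite normrM gtr0_norm //.
  have H1 : e * (1 + `|g y|) <= `|f y| / 2.
    rewrite -ler_pdivlMr //; apply: le_trans le_d _.
    by rewrite /d (negPf fy) mulrAC.
  have : 0 < `|f y| by rewrite normr_gt0.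
  nra.
move: Hb; rewrite ltr_norml => /andP[Hb1 Hb2]; split=> fy0.
  by move: Hb1; rewrite gtr0_norm //; lra.
by move: Hb2; rewrite ltr0_norm //; lra.
Qed.

Definition separated (s1 s2 : seq 'rV[R]_2) :=
  exists2 u, affine u &
    (forall x, x \in s1 -> 0 < u x) /\ (forall x, x \in s2 -> u x < 0).

(** The separator is [f + e * g + d]: a first small [e] lets [g] break the ties [f = 0], then a
    smaller shift [d] pushes the points of [s1] with [f = g = 0] to the positive side. Geometrically
    the line [f = 0] is turned slightly. *)
Lemma lex_separated (s1 s2 : seq 'rV[R]_2) f g : affine f -> affine g ->
  (forall x, x \in s1 -> 0 < f x \/ f x = 0 /\ 0 <= g x) ->
  (forall x, x \in s2 -> f x < 0 \/ f x = 0 /\ g x < 0) ->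
  separated s1 s2.
Proof.
move=> af ag H1 H2.
have [e e_gt0 He] := small_perturbation (s1 ++ s2) f g.
pose f' x := f x + e * g x.
have [d d_gt0 Hd] := small_perturbation (s1 ++ s2) f' (fun=> 1).
exists (fun x => 1 * f x + e * g x + d); first exact: affine_comb.
split=> x xs.
  have xs' : x \in s1 ++ s2 by rewrite mem_cat xs.
  have [He1 _] := He x xs'; have [Hd1 _] := Hd x xs'.
  have [/He1 /Hd1|[fx gx]] := H1 x xs; first by rewrite /f'; lra.
  by rewrite fx; nra.
have xs' : x \in s1 ++ s2 by rewrite mem_cat xs orbT.
have [_ He1] := He x xs'; have [_ Hd1] := Hd x xs'.
have [/He1 /Hd1|[fx gx]] := H2 x xs; first by rewrite /f'; lra.
have /Hd1 : f' x < 0 by rewrite /f' fx; nra.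
by rewrite /f'; lra.
Qed.

(** Up to scale, [h] is the offset from the line and [k] the position along it, whence the
    injectivity of [k] on [h = 0]. The last clause is the converse, used to find points off the
    line. *)
Lemma collinear_affine (S : {fset 'rV[R]_2}) : collinear S ->
  exists h k : 'rV[R]_2 -> R, [/\ affine h, affine k,
    forall x, x \in S -> h x = 0,
    forall x y, h x = 0 -> h y = 0 -> k x = k y -> x = y &
    forall S' : {fset 'rV[R]_2}, (forall x, x \in S' -> h x = 0) ->
      collinear S'].
Proof.
move=> [p [d [d0 HS]]].
have N : d 0 0 ^+ 2 + d 0 1 ^+ 2 != 0.
  apply: contra d0; rewrite paddr_eq0 ?sqr_ge0 // !sqrf_eq0.
  move=> /andP[/eqP e0 /eqP e1].
  by apply/eqP/rV2P; rewrite ?e0 ?e1 mxE.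
pose h x := d 0 1 * (x 0 0 - p 0 0) - d 0 0 * (x 0 1 - p 0 1).
pose k x := d 0 0 * (x 0 0 - p 0 0) + d 0 1 * (x 0 1 - p 0 1).
have Hline x : h x = 0 ->
    x = p + (k x / (d 0 0 ^+ 2 + d 0 1 ^+ 2)) *: d.
  rewrite /h /k => h0; apply: rV2P; rewrite !mxE.
    (* Adding a multiple of [h x], which is zero, makes the equality a formal identity for
       [field]. *)
    transitivity (p 0 0 + (k x * d 0 0 + h x * d 0 1) /
      (d 0 0 ^+ 2 + d 0 1 ^+ 2)); rewrite /k /h; first by field.
    by rewrite h0; field.
  transitivity (p 0 1 + (k x * d 0 1 - h x * d 0 0) /
    (d 0 0 ^+ 2 + d 0 1 ^+ 2)); rewrite /k /h; first by field.
  by rewrite h0; field.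
exists h, k; split.
- exists (d 0 1), (- d 0 0), (d 0 0 * p 0 1 - d 0 1 * p 0 0) => x.
  by rewrite /h; ring.
- exists (d 0 0), (d 0 1), (- d 0 0 * p 0 0 - d 0 1 * p 0 1) => x.
  by rewrite /k; ring.
- by move=> x /HS[t ->]; rewrite /h !mxE; ring.
- by move=> x y /Hline Hx /Hline Hy Ek; rewrite Hx Hy Ek.
- move=> S' HS'; exists p, d; split=> // x /HS' /Hline Hx.
  by eexists; exact: Hx.
Qed.

Lemma affine_zero_collinear (a b c : R) (S : {fset 'rV[R]_2}) :
  (a != 0) || (b != 0) ->
  (forall x, x \in S -> a * x 0 0 + b * x 0 1 + c = 0) -> collinear S.
Proof.
move=> ab HS.
have N : a ^+ 2 + b ^+ 2 != 0.
  by rewrite paddr_eq0 ?sqr_ge0 // !sqrf_eq0 negb_and.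
pose n2 := a ^+ 2 + b ^+ 2.
(* The base point is the foot of the perpendicular from the origin; the direction is [(-b, a)]. *)
exists (\row_(i < 2) (if i == 0 then - a * c / n2 else - b * c / n2)).
exists (\row_(i < 2) (if i == 0 then - b else a)); split.
  apply: contraTneq ab => /rowP e0.
  have := e0 0; have := e0 1; rewrite !mxE /= => -> /eqP.
  by rewrite oppr_eq0 => /eqP ->; rewrite eqxx.
move=> x /HS E; exists ((a * x 0 1 - b * x 0 0) / n2).
apply: rV2P; rewrite !mxE /= /n2.
  transitivity ((- a * c + a * (a * x 0 0 + b * x 0 1 + c)
     - b * (a * x 0 1 - b * x 0 0)) / (a ^+ 2 + b ^+ 2)); first by field.
  by rewrite E; field.
transitivity ((- b * c + b * (a * x 0 0 + b * x 0 1 + c)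
   + a * (a * x 0 1 - b * x 0 0)) / (a ^+ 2 + b ^+ 2)); first by field.
by rewrite E; field.
Qed.

End AffineFunctions.

(** * Lexicographic comparison by two real keys *)

Section LexicographicOrder.
Variables (R : realType) (T : eqType).

Definition lexle (a b : T -> R) (x y : T) :=
  (a x < a y) || (a x == a y) && (b x <= b y).
Arguments lexle a b x y /.

Lemma lexle_total (a b : T -> R) : total (lexle a b).
Proof.
by move=> x y /=; case: (ltgtP (a x) (a y)) => //= _; exact: le_total.
Qed.

Lemma lexle_trans (a b : T -> R) : transitive (lexle a b).
Proof.
move=> y x z /= /orP[xy|/andP[/eqP -> xy]] /orP[yz|/andP[/eqP <- yz]].
- by rewrite (lt_trans xy yz).
- by rewrite xy.
- by rewrite yz.
- by rewrite eqxx (le_trans xy yz) orbT.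
Qed.

Lemma exists_least (r : rel T) (s : seq T) :
  total r -> transitive r -> s != [::] ->
  exists2 m, m \in s & forall x, x \in s -> r m x.
Proof.
move=> rt rtr s0; case E: (sort r s) => [|m t].
  by move: s0; rewrite -size_eq0 -(size_sort r) E.
exists m; first by rewrite -(mem_sort r) E mem_head.
move=> x; rewrite -(mem_sort r) E inE => /predU1P[->|xt].
  by have := rt m m; rewrite orbb.
have := sort_sorted rt s; rewrite E /= => /(order_path_min rtr)/allP.
exact.
Qed.

End LexicographicOrder.
Arguments lexle {R T} a b x y /.

(** * Plane subgraphs: separated unions and fans from a point *)

Section PlaneSubgraphs.
Variable R : realType.
Notation point := 'rV[R]_2.
Implicit Types (A B : {fset point}) (E F : {fset point * point}).
Implicit Types (u g h : point -> R).

Definition has_plane_subgraph A B (k : nat) :=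
  exists E, [/\ bivisibility_subgraph A B E, non_crossing E & (k <= #|` E|)%N].

Definition compatible (e f : point * point) := forall x,
  in_closed_segment e.1 e.2 x -> in_closed_segment f.1 f.2 x ->
  endpoint e x /\ endpoint f x.

Lemma in_closed_segment_sym (v w x : point) :
  in_closed_segment v w x -> in_closed_segment w v x.
Proof.
move=> [t t01 ->]; exists (1 - t); first lra.
by rewrite subKr addrC.
Qed.

Lemma in_open_segment_sym (v w x : point) :
  in_open_segment v w x -> in_open_segment w v x.
Proof.
move=> [t t01 ->]; exists (1 - t); first lra.
by rewrite subKr addrC.
Qed.

Lemma closed_segment_cases (v w x : point) :
  in_closed_segment v w x -> [\/ x = v, x = w | in_open_segment v w x].
Proof.
move=> [t /andP[]]; rewrite le_eqVlt => /predU1P[<- _ ->|t0].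
  by constructor 1; rewrite subr0 scale1r scale0r addr0.
rewrite le_eqVlt => /predU1P[-> ->|t1 ->].
  by constructor 2; rewrite subrr scale0r scale1r add0r.
by constructor 3; exists t => //; rewrite t0.
Qed.

Lemma has_plane_subgraph_swap A B k :
  has_plane_subgraph A B k -> has_plane_subgraph B A k.
Proof.
move=> [E [sE nE kE]].
pose sw (e : point * point) := (e.2, e.1).
have sw_inj : injective sw by move=> [a b] [c d] [-> ->].
exists (sw @` E)%fset; split; last by rewrite card_imfset.
- move=> _ /imfsetP[e /= eE ->]; have [eA eB vis] := sE e eE.
  split=> //= x; rewrite fsetUC => xAB /in_open_segment_sym; exact: vis.
- move=> _ _ /imfsetP[e /= eE ->] /imfsetP[f /= fE ->] nef x /=.
  move=> /in_closed_segment_sym xe /in_closed_segment_sym xf.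
  have ne : e <> f by move=> ef; apply: nef; rewrite ef.
  have [He Hf] := nE e f eE fE ne x xe xf.
  by split; rewrite /endpoint /=; [case: He | case: Hf]; auto.
Qed.

Lemma has_plane_subgraph_le A B k l :
  (l <= k)%N -> has_plane_subgraph A B k -> has_plane_subgraph A B l.
Proof.
by move=> lk [E [? ? kE]]; exists E; split=> //; apply: leq_trans kE.
Qed.

Lemma has_plane_subgraph0 A B : has_plane_subgraph A B 0.
Proof. by exists fset0; split=> // e; rewrite ?inE. Qed.

(** Take a closest pair of opposite colours: a point inside its segment, whatever its colour, would
    form a closer pair with one endpoint. The l1 distance is used, which also scales linearly along
    a segment. *)
Lemma closest_pair_edge A B : [disjoint A & B]%fset ->
  A != fset0 -> B != fset0 -> has_plane_subgraph A B 1.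
Proof.
move=> dAB /fset0Pn[a0 a0A] /fset0Pn[b0 b0B].
pose d (e : point * point) := `|e.1 0 0 - e.2 0 0| + `|e.1 0 1 - e.2 0 1|.
pose s := allpairs pair (enum_fset A) (enum_fset B).
have s0 : s != [::].
  apply/eqP => E0; have : (a0, b0) \in s by apply: allpairs_f.
  by rewrite E0.
(* With both keys equal to [d], [lexle] is plain comparison by [d]. *)
have [[a b] ab_s Hmin] :=
  exists_least (lexle_total d d) (@lexle_trans _ _ d d) s0.
have [aA bB] : a \in A /\ b \in B.
  by case/allpairsP: ab_s => [[a' b'] /= [? ? [-> ->]]].
have dmin x y : x \in A -> y \in B -> d (a, b) <= d (x, y).
  move=> xA yB; have /Hmin : (x, y) \in s by apply: allpairs_f.
  by move=> /= /orP[/ltW //|/andP[/eqP ->]].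
have dab : 0 < d (a, b).
  rewrite lt_def addr_ge0 ?normr_ge0 // andbT paddr_eq0 ?normr_ge0 //.
  rewrite !normr_eq0 !subr_eq0 /=.
  apply/negP => /andP[/eqP e0 /eqP e1].
  by move/fdisjointP: dAB => /(_ a aA); rewrite (rV2P e0 e1) bB.
exists [fset (a, b)]%fset; split; last by rewrite cardfs1.
  move=> e; rewrite inE => /eqP ->; split=> //= x xAB [t /andP[t0 t1] Ex].
  have scale_norm (c z : R) : 0 < c -> `|c * z| = c * `|z|.
    by move=> c0; rewrite normrM gtr0_norm.
  have dax : d (a, x) = t * d (a, b).
    have dE i : a 0 i - x 0 i = t * (a 0 i - b 0 i) by rewrite Ex !mxE; ring.
    by rewrite /d /= !dE !scale_norm // mulrDr.
  have dxb : d (x, b) = (1 - t) * d (a, b).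
    have dE i : x 0 i - b 0 i = (1 - t) * (a 0 i - b 0 i).
      by rewrite Ex !mxE; ring.
    by rewrite /d /= !dE !scale_norm ?subr_gt0 // mulrDr.
  move: xAB; rewrite inE => /orP[xA|xB].
    by have := dmin _ _ xA bB; rewrite dxb; nra.
  by have := dmin _ _ aA xB; rewrite dax; nra.
by move=> e f; rewrite !inE => /eqP -> /eqP ->.
Qed.

Lemma plane_subgraphU A B E F :
  bivisibility_subgraph A B E -> bivisibility_subgraph A B F ->
  non_crossing E -> non_crossing F ->
  (forall e f, e \in E -> f \in F -> compatible e f) ->
  [disjoint E & F]%fset ->
  [/\ bivisibility_subgraph A B (E `|` F)%fset,
      non_crossing (E `|` F)%fset &
      #|` (E `|` F)%fset| = (#|` E| + #|` F|)%N].
Proof.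
move=> sE sF nE nF EF dEF; split; last first.
- by rewrite -cardfsUI disjoint_fsetI0 // cardfs0 addn0.
- move=> e f; rewrite !inE => /orP[eE|eF] /orP[fE|fF] nef x xe xf.
  + exact: nE.
  + exact: EF.
  + by have [] := EF _ _ fE eF x xf xe.
  + exact: nF.
by move=> e; rewrite inE => /orP[/sE|/sF].
Qed.

Lemma affine_closed_pos u v w x : affine u ->
  0 < u v -> 0 < u w -> in_closed_segment v w x -> 0 < u x.
Proof.
by move=> au uv uw [t t01 ->]; rewrite affine_segment //; nra.
Qed.

Lemma affine_closed_neg u v w x : affine u ->
  u v < 0 -> u w < 0 -> in_closed_segment v w x -> u x < 0.
Proof.
by move=> au uv uw [t t01 ->]; rewrite affine_segment //; nra.
Qed.

Lemma open_closed_segment (v w x : point) :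
  in_open_segment v w x -> in_closed_segment v w x.
Proof. by move=> [t /andP[t0 t1] ->]; exists t => //; rewrite !ltW. Qed.

(** Half-planes are convex: an edge between points with [u > 0] stays there, so points with [u < 0]
    cannot block it. *)
Lemma bivisibility_subgraph_sep A1 B1 A2 B2 E u : affine u ->
  (forall x, x \in (A1 `|` B1)%fset -> 0 < u x) ->
  (forall x, x \in (A2 `|` B2)%fset -> u x < 0) ->
  bivisibility_subgraph A1 B1 E ->
  bivisibility_subgraph (A1 `|` A2)%fset (B1 `|` B2)%fset E.
Proof.
move=> au u1 u2 sE e eE; have [eA eB vis] := sE e eE.
split; rewrite ?inE ?eA ?eB // => x xAB xe.
have ux : 0 < u x.
  by apply: affine_closed_pos (open_closed_segment xe) => //; apply: u1;
     rewrite inE ?eA ?eB ?orbT.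
have [x1|nx1] := boolP (x \in (A1 `|` B1)%fset); first exact: vis xe.
suff /u2 : x \in (A2 `|` B2)%fset by lra.
by move: xAB nx1; rewrite !inE; do 4!case: (x \in _).
Qed.

(** The line [u = 0] keeps the two edge sets apart. The last clause remembers which part an edge
    comes from, so that [fan_from] can exclude crossings with it. *)
Lemma has_plane_subgraph_sep A1 B1 A2 B2 u k1 k2 : affine u ->
  (forall x, x \in (A1 `|` B1)%fset -> 0 < u x) ->
  (forall x, x \in (A2 `|` B2)%fset -> u x < 0) ->
  has_plane_subgraph A1 B1 k1 -> has_plane_subgraph A2 B2 k2 ->
  exists E, [/\ bivisibility_subgraph (A1 `|` A2)%fset (B1 `|` B2)%fset E,
    non_crossing E, (k1 + k2 <= #|` E|)%N &
    forall e, e \in E ->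
      bivisibility_edge A1 B1 e \/ bivisibility_edge A2 B2 e].
Proof.
move=> au u1 u2 [E1 [s1 n1 k1E]] [E2 [s2 n2 k2E]].
have uE1 e : e \in E1 -> 0 < u e.1 /\ 0 < u e.2.
  by move=> /s1[e1 e2 _]; split; apply: u1; rewrite inE ?e1 ?e2 ?orbT.
have uE2 e : e \in E2 -> u e.1 < 0 /\ u e.2 < 0.
  by move=> /s2[e1 e2 _]; split; apply: u2; rewrite inE ?e1 ?e2 ?orbT.
have [||||||sE nE cE] :=
  @plane_subgraphU (A1 `|` A2)%fset (B1 `|` B2)%fset E1 E2.
- exact: bivisibility_subgraph_sep au u1 u2 s1.
- rewrite (fsetUC A1) (fsetUC B1).
  apply: (bivisibility_subgraph_sep (affine_opp au)) s2 => x xs.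
    by rewrite oppr_gt0 u2.
  by rewrite oppr_lt0 u1.
- exact: n1.
- exact: n2.
- move=> e f /uE1[e1 e2] /uE2[f1 f2] x xe xf.
  have ux := affine_closed_pos au e1 e2 xe.
  by have := affine_closed_neg au f1 f2 xf; rewrite ltNge ltW.
- apply/fdisjointP => e /uE1[e1 _]; apply/negP => /uE2[e1' _]; lra.
exists (E1 `|` E2)%fset; split=> //; first by rewrite cE leq_add.
by move=> e; rewrite inE => /orP[/s1|/s2]; auto.
Qed.

(* The line [g = 0] supports [A1 `|` B1] at [p], so every segment from [p] to
   the line [h = 0] leaves the hull of [A1 `|` B1] at [p]. *)
Lemma fan_from A1 B1 A2 B2 k1 k2 p u g h : affine u -> affine g -> affine h ->
  (forall x, x \in (A1 `|` B1)%fset -> 0 < u x) ->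
  (forall x, x \in (A2 `|` B2)%fset -> u x < 0) ->
  p \in A1 -> g p = 0 -> h p != 0 ->
  (forall x, x \in (A1 `|` B1)%fset -> g x <= 0) ->
  (forall x, x \in (A2 `|` B2)%fset -> 0 < g x) ->
  (forall x, x \in (A2 `|` B2)%fset -> h x = 0) ->
  has_plane_subgraph A1 B1 k1 -> has_plane_subgraph A2 B2 k2 ->
  has_plane_subgraph (A1 `|` A2)%fset (B1 `|` B2)%fset (k1 + k2 + #|` B2|)%N.
Proof.
move=> au ag ah u1 u2 pA gp hp g1 g2 h2 H1 H2.
have [E [sE nE kE sepE]] := has_plane_subgraph_sep au u1 u2 H1 H2.
pose fan q : point * point := (p, q).
have fan_inj : injective fan by move=> q q' [].
have B2P q : q \in B2 -> [/\ q \in (A2 `|` B2)%fset, 0 < g q & h q = 0].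
  move=> qB; have q2 : q \in (A2 `|` B2)%fset by rewrite inE qB orbT.
  by split; [|exact: g2|exact: h2].
have p1 : p \in (A1 `|` B1)%fset by rewrite inE pA.
have sF : bivisibility_subgraph (A1 `|` A2)%fset (B1 `|` B2)%fset
    (fan @` B2)%fset.
  move=> _ /imfsetP[q /= qB ->]; have [q2 gq hq] := B2P q qB.
  split; rewrite ?inE ?pA ?qB ?orbT //= => x xAB [t t01 Ex].
  (* A blocking point [x] is kept out of the first part by [g x > 0] and out of the second by
     [h x != 0]. *)
  have gx : 0 < g x by rewrite Ex affine_segment // gp; nra.
  have hx : h x != 0.
    rewrite Ex affine_segment // hq mulr0 addr0 mulf_neq0 //.
    by apply/eqP; lra.
  have [/g1|nx1] := boolP (x \in (A1 `|` B1)%fset); first lra.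
  have /h2 : x \in (A2 `|` B2)%fset.
    by move: xAB nx1; rewrite !inE; do 4!case: (x \in _).
  by apply/eqP.
have nF : non_crossing (fan @` B2)%fset.
  move=> _ _ /imfsetP[q /= qB ->] /imfsetP[q' /= q'B ->] nqq x /=.
  have [_ _ hq] := B2P q qB; have [_ _ hq'] := B2P q' q'B.
  move=> [t t01 Ex] [t' t01' Ex'].
  (* At parameter [t], [h] equals [(1 - t) * h p] on every fan segment, so a common point has the
     same parameter on both. *)
  have Ett : t = t'.
    have : h x = h x by []; rewrite {1}Ex Ex' !affine_segment // hq hq'.
    rewrite !mulr0 !addr0 => /(mulIf hp); lra.
  suff t0 : t = 0.
    by split; left => /=; rewrite Ex t0 subr0 scale1r scale0r addr0.
  apply/eqP; apply: contra_notT nqq => nt0; congr fan.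
  move: Ex; rewrite Ex' -Ett => /addrI /(scalerI nt0); exact: esym.
have EF e f : e \in E -> f \in (fan @` B2)%fset -> compatible e f.
  move=> eE /imfsetP[q /= qB ->] x xe [t t01 Ex].
  have [q2 gq hq] := B2P q qB.
  (* An edge of the first part lies in [g <= 0], which the fan segment meets only at [p]; an edge of
     the second lies on [h = 0], which it meets only at [q]. Being a vertex, the common point is not
     interior to the edge [e]. *)
  have [ee|ee] := sepE e eE; have [ee1 ee2 vis] := ee.
    have gx : g x <= 0.
      have [s s01 ->] := xe; rewrite affine_segment //.
      have ge1 : g e.1 <= 0 by apply: g1; rewrite inE ee1.
      have ge2 : g e.2 <= 0 by apply: g1; rewrite inE ee2 orbT.
      nra.
    have t0 : t = 0.
      by move: gx; rewrite Ex affine_segment // gp; nra.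
    have xp : x = p by rewrite Ex t0 subr0 scale1r scale0r addr0.
    split; last by left.
    have [->|->|xo] := closed_segment_cases xe; [by left|by right|].
    by case: (vis p p1); rewrite -xp.
  have hx : h x = 0.
    have [s s01 ->] := xe; rewrite affine_segment //.
    by rewrite !h2 ?mulr0 ?addr0 // inE ?ee1 ?ee2 ?orbT.
  have xq : x = q.
    move: hx; rewrite Ex affine_segment // hq mulr0 addr0 => /eqP.
    rewrite mulf_eq0 (negPf hp) orbF subr_eq0 => /eqP <-.
    by rewrite subrr scale0r scale1r add0r.
  split; last by right.
  have [->|->|xo] := closed_segment_cases xe; [by left|by right|].
  by case: (vis q q2); rewrite -xq.
have dEF : [disjoint E & fan @` B2]%fset.
  apply/fdisjointP => e eE; apply/negP => /imfsetP[q /= qB Ee].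
  have [q2 _ _] := B2P q qB; have uq := u2 q q2; have up := u1 p p1.
  have [[]|[]] := sepE e eE; rewrite Ee /= => e1 e2 _.
    by have := u1 q; rewrite inE e2 orbT => /(_ isT); lra.
  by have := u2 p; rewrite inE e1 => /(_ isT); lra.
have [sU nU cU] := plane_subgraphU sE sF nE nF EF dEF.
exists (E `|` fan @` B2)%fset; split=> //.
by rewrite cU leq_add // card_imfset.
Qed.

(* [p] maximizes [h / u] over [X], with value [c]; then [g = h - c * u]. *)
Lemma supporting_point (X Q : {fset point}) u h (k : point -> R) :
  affine u -> affine h ->
  (forall x, x \in X -> 0 < u x) ->
  (forall x, x \in Q -> u x < 0 /\ h x = 0) ->
  (exists2 x, x \in X & h x != 0) ->
  exists p g, [/\ affine g, p \in X, h p != 0, g p = 0 &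
    (forall x, x \in Q -> 0 < g x) /\
    (forall x, x \in X -> g x < 0 \/ g x = 0 /\ k x <= k p)].
Proof.
move=> au ah uX uQ [x0 x0X hx0].
wlog hx0_gt0 : h ah uQ hx0 / 0 < h x0.
  move=> H; have [hx|hx|/eqP hx] := ltgtP (h x0) 0;
    last by rewrite (negPf hx0) in hx.
  - have [|x xQ|||p [g [ag pX hp gp Hg]]] := H (fun x => - h x).
    + exact: affine_opp.
    + by have [-> ->] := uQ x xQ; rewrite oppr0.
    + by rewrite oppr_eq0.
    + by rewrite oppr_gt0.
    by exists p, g; split=> //; rewrite oppr_eq0 in hp.
  - exact: H.
pose r x := h x / u x.
have X0 : enum_fset X != [::].
  by apply/eqP => X0; have : x0 \in enum_fset X by []; rewrite X0.
(* Negated keys turn the least element into a maximizer of [r], ties going to the largest [k]. *)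
have [p pX Hp] := exists_least (lexle_total (fun x => - r x) (fun x => - k x))
  (@lexle_trans _ _ _ _) X0.
have up := uX p pX.
have rp : 0 < r p.
  apply: (@lt_le_trans _ _ (r x0)); first by rewrite divr_gt0 ?uX.
  by have /orP[|/andP[/eqP]] := Hp x0 x0X; rewrite /=; lra.
exists p, (fun x => 1 * h x + (- r p) * u x + 0); split=> //.
- exact: affine_comb.
- by apply: contraTneq rp => hp; rewrite /r hp mul0r ltxx.
- by rewrite /r; field; apply/lt0r_neq0.
split=> x xX.
  by have [ux hx] := uQ x xX; rewrite hx; nra.
have ux := uX x xX.
have Eh : h x = r x * u x by rewrite /r divfK // lt0r_neq0.
have /orP[/= rx|/= /andP[/eqP rx kx]] := Hp x xX; [left|right]; rewrite Eh.
  by nra.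
have -> : r x = r p by lra.
by split; [ring | lra].
Qed.

(** The supporting point may have either colour and is joined to the points of the other colour on
    the line, hence the minimum. Any supporting point will do, so the tie-breaking key is
    constant. *)
Lemma fan A1 B1 A2 B2 k1 k2 u h : affine u -> affine h ->
  (forall x, x \in (A1 `|` B1)%fset -> 0 < u x) ->
  (forall x, x \in (A2 `|` B2)%fset -> u x < 0) ->
  (forall x, x \in (A2 `|` B2)%fset -> h x = 0) ->
  (exists2 x, x \in (A1 `|` B1)%fset & h x != 0) ->
  has_plane_subgraph A1 B1 k1 -> has_plane_subgraph A2 B2 k2 ->
  has_plane_subgraph (A1 `|` A2)%fset (B1 `|` B2)%fset
    (k1 + k2 + minn #|` A2| #|` B2|)%N.
Proof.
move=> au ah u1 u2 h2 h1 H1 H2.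
have [|p [g [ag pX hp gp [g2 g1]]]] :=
    @supporting_point _ (A2 `|` B2)%fset u h (fun=> 0) au ah u1 _ h1.
  by move=> x xs; rewrite u2 ?h2.
have g1' x : x \in (A1 `|` B1)%fset -> g x <= 0.
  by move=> /g1[/ltW //|[-> _]].
move: pX; rewrite inE => /orP[pA|pB].
  have := fan_from au ag ah u1 u2 pA gp hp g1' g2 h2 H1 H2.
  by apply: has_plane_subgraph_le; rewrite leq_add2l geq_minr.
apply: has_plane_subgraph_swap.
rewrite !(fsetUC _ B1) !(fsetUC _ B2) in u1 u2 g1' g2 h2.
have := fan_from au ag ah u1 u2 pB gp hp g1' g2 h2
  (has_plane_subgraph_swap H1) (has_plane_subgraph_swap H2).
by apply: has_plane_subgraph_le; rewrite leq_add2l geq_minl.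
Qed.

End PlaneSubgraphs.

(** * Gluing two collinear parts *)

Section TwoLines.
Variable R : realType.
Notation point := 'rV[R]_2.
Implicit Types (A B : {fset point}) (u g h k : point -> R).

(** After its fan to the first line, [p] is counted with the first part. A second fan goes from that
    part to the rest of the second line; its apex is off [h2 = 0], hence not [p]. The fans give [m1]
    and [m2] edges, and each line has one edge of its own. *)
Lemma two_fans A1 B1 A2 B2 m1 m2 p u u' h1 h2 :
  affine u -> affine u' -> affine h1 -> affine h2 ->
  [disjoint A1 & B1]%fset -> [disjoint A2 & B2]%fset ->
  #|` A1| = m1 -> #|` B1| = m1 -> #|` A2| = m2.+1 -> #|` B2| = m2.+1 ->
  (0 < m1)%N -> (0 < m2)%N ->
  (forall x, x \in (A1 `|` B1)%fset -> u x < 0) -> 0 < u p ->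
  (forall x, x \in (A1 `|` B1)%fset -> h1 x = 0) -> h1 p != 0 ->
  (forall x, x \in (A2 `|` B2)%fset -> h2 x = 0) ->
  (exists2 x, x \in (A1 `|` B1)%fset & h2 x != 0) ->
  p \in A2 -> (forall x, x \in p |` (A1 `|` B1)%fset -> 0 < u' x)%fset ->
  (forall x, x \in (A2 `|` B2) `\ p -> u' x < 0)%fset ->
  has_plane_subgraph (A1 `|` A2)%fset (B1 `|` B2)%fset (m1 + m2.+1 + 1)%N.
Proof.
move=> au au' ah1 ah2 d1 d2 cA1 cB1 cA2 cB2 m1_gt0 m2_gt0.
move=> u1 up h11 h1p h22 [y yP hy] pA u'1 u'2.
have pB : p \notin B2 by move/fdisjointP: d2 => /(_ p pA).
have H1 : has_plane_subgraph ([fset p] `|` A1)%fset (fset0 `|` B1)%fset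
    (0 + 1 + minn #|` A1| #|` B1|)%N.
  apply: (fan au ah1) => //.
  - by move=> x; rewrite !inE orbF => /eqP ->.
  - by exists p => //; rewrite !inE eqxx.
  - exact: has_plane_subgraph0.
  - by apply: closest_pair_edge => //; rewrite -cardfs_gt0 ?cA1 ?cB1.
rewrite cA1 cB1 minnn fset0U in H1.
have cA2' : #|` (A2 `\ p)%fset| = m2.
  by have := cardfsD1 p A2; rewrite cA2 pA => -[].
have d2' : [disjoint A2 `\ p & B2]%fset.
  by apply: fdisjointWl d2; apply: fsubD1set.
have H2 : has_plane_subgraph (([fset p] `|` A1) `|` (A2 `\ p))%fset
    (B1 `|` B2)%fset (0 + 1 + m1 + 1 + minn #|` (A2 `\ p)%fset| #|` B2|)%N.
  apply: (fan au' ah2) H1 _.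
  - by move=> x; rewrite -fsetUA; exact: u'1.
  - move=> x; rewrite !inE => xs; apply: u'2; rewrite !inE.
    case/orP: xs => [/andP[-> ->] //|xB]; rewrite xB orbT andbT.
    by apply: contraNneq pB => <-.
  - move=> x; rewrite !inE => xs; apply: h22; rewrite inE.
    by case/orP: xs => [/andP[_ ->]|->]; rewrite ?orbT.
  - by exists y => //; move: yP; rewrite !inE -orbA => ->; rewrite orbT.
  - by apply: closest_pair_edge => //; rewrite -cardfs_gt0 ?cA2' ?cB2.
have -> : (A1 `|` A2 = ([fset p] `|` A1) `|` (A2 `\ p))%fset.
  apply/fsetP => x; rewrite !inE; have [->|] //= := eqVneq x p.
  by rewrite pA orbT.
apply: has_plane_subgraph_le H2; rewrite cA2' cB2; lia.
Qed.

Lemma two_lines A1 B1 A2 B2 m1 m2 u h1 h2 k :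
  affine u -> affine h1 -> affine h2 -> affine k ->
  [disjoint A1 & B1]%fset -> [disjoint A2 & B2]%fset ->
  #|` A1| = m1 -> #|` B1| = m1 -> #|` A2| = m2 -> #|` B2| = m2 ->
  (0 < m1)%N -> (0 < m2)%N ->
  (forall x, x \in (A1 `|` B1)%fset -> u x < 0) ->
  (forall x, x \in (A2 `|` B2)%fset -> 0 < u x) ->
  (forall x, x \in (A1 `|` B1)%fset -> h1 x = 0) ->
  (exists2 x, x \in (A2 `|` B2)%fset & h1 x != 0) ->
  (forall x, x \in (A2 `|` B2)%fset -> h2 x = 0) ->
  (exists2 x, x \in (A1 `|` B1)%fset & h2 x != 0) ->
  (forall x y, h2 x = 0 -> h2 y = 0 -> k x = k y -> x = y) ->
  has_plane_subgraph (A1 `|` A2)%fset (B1 `|` B2)%fset (m1 + m2 + 1)%N.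
Proof.
move=> au ah1 ah2 ak d1 d2 cA1 cB1 cA2 cB2 m1_gt0 m2_gt0.
move=> u1 u2 h11 h12 h22 h21 k_inj.
have K2 : has_plane_subgraph A2 B2 1.
  by apply: closest_pair_edge => //; rewrite -cardfs_gt0 ?cA2 ?cB2.
(* With one point of each colour in the second part, removing [p] would leave no edge there; a
   single fan to the first line already gives [m1 + 2] edges. *)
case: m2 cA2 cB2 m2_gt0 => // -[|m2] cA2 cB2 _.
  have K1 : has_plane_subgraph A1 B1 1.
    by apply: closest_pair_edge => //; rewrite -cardfs_gt0 ?cA1 ?cB1.
  rewrite (fsetUC A1) (fsetUC B1).
  apply: has_plane_subgraph_le (fan au ah1 u2 u1 h11 h12 K2 K1).
  by rewrite cA1 cB1; lia.
have [|p [g [ag pX hp gp [g1 g2]]]] :=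
    @supporting_point _ _ (A1 `|` B1)%fset u h1 k au ah1 u2 _ h12.
  by move=> x xs; rewrite u1 ?h11.
(* On the supporting line [g = 0], [p] is the last point of the second part along [k]; turning the
   line slightly cuts off [p] together with the first part. *)
have [||||u' au' [u'1 u'2]] :=
  @lex_separated _ (p |` (A1 `|` B1))%fset ((A2 `|` B2) `\ p)%fset g
    (fun x => 1 * k x + 0 * k x + (- k p)).
- exact: ag.
- exact: affine_comb.
- move=> x; rewrite inE => /orP[|/g1]; last by left.
  by rewrite inE => /eqP ->; right; split=> //; lra.
- move=> x; rewrite 2!inE => /andP[xp xs].
  have [|[gx kx]] := g2 x xs; [by left|right; split=> //].
  rewrite mul0r mul1r addr0 subr_lt0 lt_neqAle kx andbT.
  by apply: contraNneq xp => /k_inj ->; rewrite ?h22.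
have up := u2 p pX.
move: (pX); rewrite inE => /orP[pA|pB].
  exact: (@two_fans _ _ _ _ _ _ p u u' h1 h2).
apply: has_plane_subgraph_swap.
rewrite !(fsetUC A1) !(fsetUC A2) in u1 h11 h22 h21 u'1 u'2.
by apply: (@two_fans _ _ _ _ _ _ p u u' h1 h2) => //; rewrite fdisjoint_sym.
Qed.

End TwoLines.

(** * Signed colour counts of prefixes *)

Section ColourSums.
Variables (T : eqType) (c : pred T).

Definition weight (x : T) : int := if c x then 1 else -1.
Definition excess (s : seq T) : int := \sum_(x <- s) weight x.

Lemma excess_cons x s : excess (x :: s) = weight x + excess s.
Proof. exact: big_cons. Qed.

Lemma excess_rcons s x : excess (rcons s x) = excess s + weight x.
Proof. by rewrite /excess big_rcons /= addrC. Qed.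

Lemma excess_perm s1 s2 : perm_eq s1 s2 -> excess s1 = excess s2.
Proof. exact: perm_big. Qed.

Lemma excess_count s :
  excess s = (count c s)%:Z - (count (predC c) s)%:Z.
Proof.
elim: s => [|x s IH]; first by rewrite /excess big_nil.
by rewrite excess_cons IH /weight /=; case: (c x) => /=; lia.
Qed.

(* Prefix sums move by unit steps, so without a zero they keep their sign. *)
Lemma prefix_excess_sign (x : T) s1 s2 :
  (forall t1 t2, x :: s1 ++ s2 = t1 ++ t2 -> t1 != [::] -> t2 != [::] ->
    excess t1 != 0) ->
  s2 != [::] -> 0 < excess (x :: s1) * weight x.
Proof.
elim/last_ind: s1 s2 => [|s1 y IH] s2 N s20.
  by rewrite excess_cons /excess big_nil /weight; case: (c x).
have {}IH : 0 < excess (x :: s1) * weight x.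
  by apply: (IH (y :: s2)) => // t1 t2; rewrite -cat_rcons; apply: N.
have : excess (x :: rcons s1 y) != 0 by apply: N s20.
rewrite -rcons_cons excess_rcons; move: IH.
have w1 z : weight z = 1 \/ weight z = -1 by rewrite /weight; case: (c z); auto.
by have [->|->] := w1 x; have [->|->] := w1 y; lia.
Qed.

End ColourSums.

(** * Existence of a balanced split by a line *)

Section BalancedSplit.
Variable R : realType.
Notation point := 'rV[R]_2.
Implicit Types (P s : seq point) (a b : point -> R).

(** The last element [q] of a prefix supplies the thresholds for the line that cuts the prefix
    off. *)
Lemma sort_lexle_split P a b s1 s2 :
  sort (lexle a b) P = s1 ++ s2 -> s1 != [::] ->
  exists2 q, q \in s1 & (forall x, x \in s1 -> lexle a b x q) /\
    (forall x, x \in s2 -> lexle a b q x).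
Proof.
move=> Es; have := sort_sorted (lexle_total a b) P.
rewrite sorted_pairwise; last exact: lexle_trans.
rewrite {}Es; case/lastP: s1 => // s1 q.
rewrite pairwise_cat pairwise_rcons.
move=> /and3P[/allrelP H12 /andP[/allP H1 _] _] _.
exists q; first by rewrite mem_rcons mem_head.
split=> x xs; last by apply: H12; rewrite // mem_rcons mem_head.
move: xs; rewrite mem_rcons inE => /predU1P[->|/H1 //].
by rewrite /= eqxx lexx orbT.
Qed.

Lemma sorted_lexle_zeros a b s : sorted (lexle a b) s ->
  (forall x, x \in s -> 0 <= a x) ->
  s = [seq x <- s | a x == 0] ++ [seq x <- s | a x != 0].
Proof.
elim: s => //= x s IH xs a0.
have {IH} Es : s = [seq x <- s | a x == 0] ++ [seq x <- s | a x != 0].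
  by apply: IH => [|y ys]; [exact: path_sorted xs | rewrite a0 // inE ys orbT].
have [ax|ax] := eqVneq (a x) 0; rewrite /=; first by rewrite -Es.
have /allP min_x := order_path_min (@lexle_trans _ _ a b) xs.
have s_pos y : y \in s -> a y != 0.
  move=> /min_x /= axy; have := a0 x (mem_head _ _).
  rewrite le_eqVlt eq_sym (negPf ax) /= => ax0.
  by apply: lt0r_neq0; case/orP: axy => [/(lt_trans ax0)|/andP[/eqP <-]].
have -> : [seq y <- s | a y == 0] = [::].
  by rewrite -(filter_pred0 s); apply: eq_in_filter => y /s_pos /negPf.
have /all_filterP -> // : all (fun y => a y != 0) s by apply/allP.
Qed.

Variables (c : pred point) (P : seq point).
Hypothesis P_uniq : uniq P.

(** The assumption refuted in [balanced_split]. *)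
Definition unsplittable := forall s1 s2, perm_eq (s1 ++ s2) P ->
  separated s1 s2 -> s1 != [::] -> s2 != [::] -> excess c s1 != 0.

Hypothesis P_unsplit : unsplittable.

(** Sweeping by [a] and reading each parallel line along [b], the points on the supporting line
    [a = 0] come first, starting with [m]. They form a proper prefix, and every prefix can be cut
    off by a line, so their excess has the sign of [m]. *)
Lemma edge_excess_sign a b m : affine a -> affine b ->
  (forall x y, a x = a y -> b x = b y -> x = y) ->
  (forall x, x \in P -> 0 <= a x) ->
  m \in P -> a m = 0 -> (forall x, x \in P -> a x = 0 -> b m <= b x) ->
  (exists2 x, x \in P & a x != 0) ->
  0 < excess c [seq x <- P | a x == 0] * weight c m.
Proof.
move=> aa ab ab_inj a0 mP am bm [z zP az].
pose s := sort (lexle a b) P.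
have sP : perm_eq s P by rewrite perm_sort.
have s_uniq : uniq s by rewrite sort_uniq.
have s_sorted : sorted (lexle a b) s := sort_sorted (lexle_total a b) P.
have Es : s = [seq x <- s | a x == 0] ++ [seq x <- s | a x != 0].
  by apply: sorted_lexle_zeros s_sorted _ => x; rewrite mem_sort; exact: a0.
have [t Est] : exists t, s = m :: t.
  have ms : m \in s by rewrite mem_sort.
  move: (s_sorted) (perm_mem sP).
  case: (s) ms => // x t; rewrite inE => /predU1P[<-|mt]; first by exists t.
  move=> xt Hmem; exists t; congr (_ :: _).
  have xP : x \in P by rewrite -Hmem mem_head.
  have /allP/(_ m mt)/= := order_path_min (@lexle_trans _ _ a b) xt.
  rewrite am; have ax := a0 x xP.
  rewrite ltNge ax /= => /andP[/eqP ax0 bx].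
  by apply: ab_inj; [rewrite ax0 am | apply/eqP; rewrite eq_le bx bm].
rewrite -(excess_perm c (perm_filter _ sP)).
set s1 := filter _ s in Es *; set s2 := filter _ s in Es.
have [t1 Es1] : exists t1, s1 = m :: t1.
  by rewrite /s1 Est /= am eqxx; eexists.
rewrite Es1; apply: (@prefix_excess_sign _ c m t1 s2); last first.
  have : z \in s2 by rewrite mem_filter az mem_sort.
  by case: (s2).
move=> u1 u2; rewrite -cat_cons -Es1 -Es => Eu u1_n u2_n.
apply: (P_unsplit (s2 := u2)) => //; first by rewrite -Eu.
have [q qu [H1 H2]] := sort_lexle_split Eu u1_n.
(* The keys are [a q - a x] and [b q - b x], in the shape of [affine_comb]. *)
apply: (@lex_separated _ _ _ (fun x => (-1) * a x + 0 * a x + a q)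
   (fun x => (-1) * b x + 0 * b x + b q)); [exact: affine_comb.. | |] => x xu.
  have /= /orP[axq|/andP[/eqP axq bxq]] := H1 x xu; [left|right]; first lra.
  by split; lra.
have /= /orP[axq|/andP[/eqP axq bxq]] := H2 x xu; [left|right]; first lra.
split; first lra.
suff : b x != b q by move/eqP; lra.
apply: contraTneq xu => bx.
have -> : x = q by apply: ab_inj.
move: s_uniq; rewrite Eu cat_uniq => /and3P[_ /hasPn H _].
by apply/negP => /H; rewrite /= qu.
Qed.

(* Sorting by the slope [k / w] at [v], farthest point first on each ray and
   [v] itself last, makes every prefix separable from the rest. *)
Lemma pencil_excess v (w k : point -> R) : affine w -> affine k ->
  (forall x y, w x = w y -> k x = k y -> x = y) ->
  w v = 0 -> k v = 0 -> v \in P ->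
  (forall x, x \in P -> x != v -> 0 < w x) ->
  (exists2 x, x \in P & x != v) -> excess c P = 0 ->
  exists p, [/\ p \in P, p != v, weight c p * weight c v < 0 &
    forall x, x \in P -> 0 <= k x - k p / w p * w x /\
      (k x - k p / w p * w x = 0 -> w x <= w p)].
Proof.
move=> aw ak wk_inj wv kv vP w_gt0 [z zP zv] cP.
pose P' := [seq x <- P | x != v].
pose r x := k x / w x.
pose s' := sort (lexle r (fun x => - w x)) P'.
have s'P x : (x \in s') = (x != v) && (x \in P) by rewrite mem_sort mem_filter.
have sP : perm_eq (rcons s' v) P.
  rewrite perm_rcons perm_sym; apply: perm_trans (perm_to_rem vP) _.
  by rewrite perm_cons rem_filter // perm_sym perm_sort; apply: perm_refl.
have s_uniq : uniq (rcons s' v) by rewrite (perm_uniq sP).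
have kE x : x \in s' -> k x = r x * w x.
  by rewrite s'P => /andP[xv xP]; rewrite /r divfK // lt0r_neq0 ?w_gt0.
have N t1 t2 : rcons s' v = t1 ++ t2 -> t1 != [::] -> t2 != [::] ->
    excess c t1 != 0.
  move=> Et t1n t2n; apply: (P_unsplit (s2 := t2)) => //; first by rewrite -Et.
  case/lastP: t2 Et t2n => // t2 y; rewrite -rcons_cat => /rcons_inj[Et <-] _.
  have [q qt [H1 H2]] := sort_lexle_split Et t1n.
  have t1s x : x \in t1 -> x \in s' by rewrite Et mem_cat => ->.
  have t2s x : x \in t2 -> x \in s' by rewrite Et mem_cat orbC => ->.
  have w_pos x : x \in s' -> 0 < w x.
    by rewrite s'P => /andP[xv xP]; apply: w_gt0.
  have wq := w_pos q (t1s q qt).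
  (* The separator comes from the line through [v] and [q], ties being broken by [w]; [v] is on this
     line and falls on the far side from the prefix because [w v < w q]. *)
  apply: (@lex_separated _ _ _ (fun x => r q * w x + (-1) * k x + 0)
    (fun x => 1 * w x + 0 * w x + (- w q))); [exact: affine_comb.. | |] => x xt.
    have wx := w_pos x (t1s x xt); rewrite (kE x (t1s x xt)).
    have /= /orP[rx|/andP[/eqP -> wxq]] := H1 x xt; [left|right]; first nra.
    by split; [ring|lra].
  move: xt; rewrite mem_rcons inE => /predU1P[->|xt].
    by right; rewrite wv kv; split; [ring|lra].
  have wx := w_pos x (t2s x xt); have kx := kE x (t2s x xt).
  have /= /orP[rx|/andP[/eqP rx wxq]] := H2 x xt; [left|right].
    by rewrite kx; nra.
  split; first by rewrite kx -rx; ring.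
  suff : w x != w q by move/eqP; lra.
  apply: contraTneq xt => wxE.
  have -> : x = q by apply: wk_inj; rewrite // kx (kE q (t1s q qt)) -rx wxE.
  move: s_uniq; rewrite rcons_uniq Et cat_uniq => /andP[_ /and3P[_ /hasPn H _]].
  by apply/negP => /H; rewrite /= qt.
have : z \in s' by rewrite s'P zv.
case Es: s' => [//|p t] _.
have ps : p \in s' by rewrite Es mem_head.
have /andP[pv pP] : (p != v) && (p \in P) by rewrite -s'P.
have wp := w_gt0 p pP pv.
have p_min x : x \in s' -> lexle r (fun x => - w x) p x.
  have := sort_sorted (lexle_total r (fun x => - w x)) P'; rewrite -/s' Es.
  move=> /(order_path_min (@lexle_trans _ _ _ _))/allP H.
  by rewrite inE => /predU1P[->|/H //]; rewrite /= eqxx lexx orbT.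
exists p; split=> //.
  have : 0 < excess c (p :: t) * weight c p.
    apply: (@prefix_excess_sign _ c p t [:: v]) => //.
    by move=> t1 t2; rewrite -cat_cons -Es cats1; apply: N.
  (* The total excess is zero, so the prefix without [v] has excess [- weight c v]. *)
  have : excess c (rcons s' v) = 0 by rewrite (excess_perm c sP).
  rewrite excess_rcons Es => /eqP; rewrite addr_eq0 => /eqP ->.
  by rewrite mulNr oppr_gt0 mulrC.
move=> x xP; have [->|xv] := eqVneq x v.
  by rewrite kv wv mulr0 subr0; split=> // _; exact: ltW.
have xs : x \in s' by rewrite s'P xv.
have wx := w_gt0 x xP xv; rewrite (kE x xs) -/(r p).
have /= /orP[rx|/andP[/eqP <- wxp]] := p_min x xs.
  by split; nra.
by rewrite subrr; split=> // _; lra.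
Qed.

End BalancedSplit.

(** Without a split, [pencil_excess] yields a hull edge from [v] to [p] with ends of opposite
    colours, while [edge_excess_sign], read along [w] and along [- w], gives the excess of the
    points on it the sign of both ends. *)
Lemma balanced_split (R : realType) (c : pred 'rV[R]_2) (P : seq 'rV[R]_2) :
  uniq P -> excess c P = 0 ->
  (forall a b d : R, (a != 0) || (b != 0) ->
    exists2 x, x \in P & a * x 0 0 + b * x 0 1 + d != 0) ->
  exists s1 s2, [/\ perm_eq (s1 ++ s2) P, separated s1 s2,
    s1 != [::], s2 != [::] & excess c s1 = 0].
Proof.
move=> P_uniq cP ncol; apply: contrapT => no_split.
have N : unsplittable c P.
  move=> s1 s2 sP sep s1n s2n; apply/eqP => s1_0.
  by apply: no_split; exists s1, s2.
have P0 : P != [::].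
  have [|x xP _] := ncol 1 0 0; first by rewrite oner_eq0.
  by apply: contraTneq xP => ->.
have [v vP v_min] := exists_least
  (lexle_total (fun x : 'rV[R]_2 => x 0 0) (fun x => x 0 1))
  (@lexle_trans _ _ _ _) P0.
(* Tilting the first coordinate by [e] makes the lexicographically least [v] the only minimum of
   [w]; [k] is the orthogonal coordinate. *)
have [e e_gt0 He] := small_perturbation P (fun x : 'rV[R]_2 => x 0 0 - v 0 0)
  (fun x => x 0 1 - v 0 1).
pose w (x : 'rV[R]_2) := x 0 0 - v 0 0 + e * (x 0 1 - v 0 1).
pose k (x : 'rV[R]_2) := x 0 1 - v 0 1 - e * (x 0 0 - v 0 0).
have aw : affine w by exists 1, e, (- v 0 0 - e * v 0 1) => x; rewrite /w; ring.
have ak : affine k.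
  by exists (- e), 1, (- v 0 1 + e * v 0 0) => x; rewrite /k; ring.
have wk_inj x y : w x = w y -> k x = k y -> x = y.
  move=> wE kE.
  have e1 : 1 + e ^+ 2 != 0 by apply: lt0r_neq0; nra.
  apply: rV2P; apply/eqP; rewrite -subr_eq0 -(mulrI_eq0 _ (mulfI e1)).
    have -> : (1 + e ^+ 2) * (x 0 0 - y 0 0) = (w x - w y) - e * (k x - k y).
      by rewrite /w /k; ring.
    by rewrite wE kE !subrr mulr0 subr0.
  have -> : (1 + e ^+ 2) * (x 0 1 - y 0 1) = (k x - k y) + e * (w x - w y).
    by rewrite /w /k; ring.
  by rewrite wE kE !subrr mulr0 addr0.
have wv : w v = 0 by rewrite /w; ring.
have kv : k v = 0 by rewrite /k; ring.
have w_gt0 x : x \in P -> x != v -> 0 < w x.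
  move=> xP xv; have [Hpos _] := He x xP; rewrite /w.
  have /= /orP[x0|/andP[/eqP x0 x1]] := v_min x xP.
    by apply: Hpos; rewrite subr_gt0.
  rewrite -x0 subrr add0r mulr_gt0 // subr_gt0 lt_neqAle x1 andbT.
  by apply: contraNneq xv => x1'; apply/eqP/rV2P.
have [|z zP wz] := ncol 1 e (- v 0 0 - e * v 0 1); first by rewrite oner_eq0.
have zv : z != v.
  by apply: contraNneq wz => ->; apply/eqP; ring.
have [|p [pP pv pcv p_min]] :=
    pencil_excess P_uniq N aw ak wk_inj wv kv vP w_gt0 _ cP.
  by exists z.
have wp := w_gt0 p pP pv.
(* The line [h = 0] joins [v] to [p] and supports [P], as [p] has the least slope [k / w]. *)
pose d := k p / w p.
pose h x := 1 * k x + (- d) * w x + 0.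
have hE x : h x = k x - d * w x by rewrite /h; ring.
have ah : affine h by apply: affine_comb.
have hw_inj x y : h x = h y -> w x = w y -> x = y.
  by rewrite !hE => hxy wxy; apply: wk_inj => //; rewrite wxy in hxy; lra.
have h_ge0 x : x \in P -> 0 <= h x by rewrite hE => /p_min[].
have hv : h v = 0 by rewrite hE wv kv; ring.
have hp : h p = 0 by rewrite hE /d divfK ?subrr // lt0r_neq0.
have h_nz : exists2 x, x \in P & h x != 0.
  (* These are the coefficients of [h]; if the first two vanished, then [d = - e] and
     [1 + e ^+ 2 = 0]. *)
  have [|x xP hx] := ncol (- e - d) (1 - d * e)
      (- v 0 1 + e * v 0 0 + d * v 0 0 + d * e * v 0 1).
    rewrite -negb_and; apply/negP => /andP[/eqP E1 /eqP E2].
    have : d = - e by lra.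
    by move=> dE; move: E2; rewrite dE; nra.
  exists x => //; apply: contraNneq hx => hx; apply/eqP; rewrite -hx hE /w /k.
  by ring.
have : 0 < excess c [seq x <- P | h x == 0] * weight c v.
  apply: (edge_excess_sign P_uniq N ah aw) => // x xP _; rewrite wv.
  by have [->|/(w_gt0 x xP)/ltW//] := eqVneq x v; rewrite wv.
have : 0 < excess c [seq x <- P | h x == 0] * weight c p.
  apply: (edge_excess_sign P_uniq N ah (affine_opp aw)) => //.
    by move=> x y hxy /oppr_inj; apply: hw_inj.
  move=> x xP hx; rewrite lerN2; have [_] := p_min x xP; apply.
  by rewrite -hE.
move: (excess _ _) pcv => X; rewrite /weight; clear.
by case: (c p); case: (c v); lia.
Qed.

(** * Partition of the two sets, and the induction *)

(** Colouring by membership in [A] turns a split of the point sequence into a split of both sets.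
    The second part is balanced because the whole is, and a nonempty balanced part has points of
    both colours. *)
Lemma balanced_partition (R : realType) (n : nat) (A B : {fset 'rV[R]_2}) :
  [disjoint A & B]%fset -> #|` A| = n -> #|` B| = n ->
  ~ collinear (A `|` B)%fset ->
  exists (A1 B1 A2 B2 : {fset 'rV[R]_2}) m1 m2 u,
    [/\ affine u, A = (A1 `|` A2)%fset, B = (B1 `|` B2)%fset,
        (n = m1 + m2)%N & (0 < m1)%N && (0 < m2)%N] /\
    [/\ #|` A1| = m1, #|` B1| = m1, #|` A2| = m2, #|` B2| = m2 &
        (forall x, x \in (A1 `|` B1)%fset -> 0 < u x) /\
        (forall x, x \in (A2 `|` B2)%fset -> u x < 0)].
Proof.
move=> dAB cA cB ncol.
pose P : seq 'rV[R]_2 := enum_fset (A `|` B)%fset.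
have PE x : (x \in P) = (x \in A) || (x \in B).
  by rewrite -[x \in P]/(x \in (A `|` B)%fset) inE.
have P_uniq : uniq P by exact: fset_uniq.
have card_part (s : seq 'rV[R]_2) (c : pred 'rV[R]_2) : uniq s ->
    #|` [fset x in [seq x <- s | c x]]%fset| = count c s.
  by move=> us; rewrite card_fseq undup_id ?filter_uniq // size_filter.
pose cl := mem A.
have AP : [fset x in [seq x <- P | cl x]]%fset = A.
  apply/fsetP => x; rewrite !inE mem_filter PE /cl /=.
  by case: (x \in A).
have BP : [fset x in [seq x <- P | predC cl x]]%fset = B.
  apply/fsetP => x; rewrite !inE mem_filter PE /cl /=.
  have [xA|] := boolP (x \in A); last by [].
  by move/fdisjointP: dAB => /(_ x xA)/negPf ->.
have cAP : count cl P = n by rewrite -card_part // AP.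
have cBP : count (predC cl) P = n by rewrite -card_part // BP.
have cP : excess cl P = 0 by rewrite excess_count cAP cBP subrr.
have [a b d ab|s1 [s2 [sP [u au [u1 u2]] s1n s2n c1]]] :=
    balanced_split P_uniq cP.
  apply: contrapT => Hn; apply: ncol.
  apply: (affine_zero_collinear (c := d) ab) => x xP.
  by apply/eqP; apply: contra_notT Hn => hx; exists x.
have us : uniq (s1 ++ s2) by rewrite (perm_uniq sP).
have us1 : uniq s1 by move: us; rewrite cat_uniq => /and3P[].
have us2 : uniq s2 by move: us; rewrite cat_uniq => /and3P[].
have sE x : (x \in s1) || (x \in s2) = (x \in P).
  by rewrite -mem_cat (perm_mem sP).
have E1 : count cl s1 = count (predC cl) s1.
  by move/eqP: c1; rewrite excess_count subr_eq0 eqz_nat => /eqP.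
have EA : (count cl s1 + count cl s2)%N = n.
  by rewrite -count_cat (permP sP).
have EB : (count (predC cl) s1 + count (predC cl) s2)%N = n.
  by rewrite -count_cat (permP sP).
have E2 : count cl s2 = count (predC cl) s2.
  by apply: (@addnI (count cl s1)); rewrite EA E1 EB.
have size1 := count_predC cl s1; have size2 := count_predC cl s2.
rewrite -!size_eq0 in s1n s2n.
exists [fset x in [seq x <- s1 | cl x]]%fset.
exists [fset x in [seq x <- s1 | predC cl x]]%fset.
exists [fset x in [seq x <- s2 | cl x]]%fset.
exists [fset x in [seq x <- s2 | predC cl x]]%fset.
exists (count cl s1), (count cl s2), u; split; split=> //.
- rewrite -{1}AP; apply/fsetP => x.
  by rewrite !inE !mem_filter -andb_orr sE.
- rewrite -{1}BP; apply/fsetP => x.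
  by rewrite !inE !mem_filter -andb_orr sE.
- apply/andP; split; rewrite lt0n.
    by apply: contraNneq s1n => c0; rewrite -size1 -E1 c0.
  by apply: contraNneq s2n => c0; rewrite -size2 -E2 c0.
- exact: card_part.
- by rewrite card_part // E1.
- exact: card_part.
- by rewrite card_part // E2.
- split=> x; rewrite !inE !mem_filter => /orP[] /andP[_];
  first [exact: u1 | exact: u2].
Qed.

Theorem theorem10 (R : realType) (n : nat) (A B : {fset 'rV[R]_2})
    (disjAB : [disjoint A & B]%fset) (cardA : #|` A| = n) (cardB : #|` B| = n)
    (ncolAB : ~ collinear (A `|` B)%fset) :
  exists E : {fset 'rV[R]_2 * 'rV[R]_2},
    [/\ bivisibility_subgraph A B E, non_crossing E & (n + 1 <= #|` E|)%N].
Proof.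
rewrite -/(has_plane_subgraph A B (n + 1)).
elim/ltn_ind: n A B disjAB cardA cardB ncolAB => n IH A B dAB cA cB ncol.
have [A1 [B1 [A2 [B2 [m1 [m2 [u]]]]]]] := balanced_partition dAB cA cB ncol.
move=> [[au EA EB En /andP[m1_gt0 m2_gt0]] [cA1 cB1 cA2 cB2 [u1 u2]]].
have d1 : [disjoint A1 & B1]%fset.
  apply/fdisjointP => x xA; apply/negP => xB; move/fdisjointP: dAB => /(_ x).
  by rewrite EA EB !inE xA xB => /(_ isT).
have d2 : [disjoint A2 & B2]%fset.
  apply/fdisjointP => x xA; apply/negP => xB; move/fdisjointP: dAB => /(_ x).
  by rewrite EA EB !inE xA xB !orbT => /(_ isT).
have K1 : has_plane_subgraph A1 B1 1.
  by apply: closest_pair_edge => //; rewrite -cardfs_gt0 ?cA1 ?cB1.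
have K2 : has_plane_subgraph A2 B2 1.
  by apply: closest_pair_edge => //; rewrite -cardfs_gt0 ?cA2 ?cB2.
have IH1 : ~ collinear (A1 `|` B1)%fset -> has_plane_subgraph A1 B1 (m1 + 1).
  by apply: IH => //; lia.
have IH2 : ~ collinear (A2 `|` B2)%fset -> has_plane_subgraph A2 B2 (m2 + 1).
  by apply: IH => //; lia.
have off_line (S : {fset 'rV[R]_2}) (h : 'rV[R]_2 -> R) :
    (forall S' : {fset 'rV[R]_2}, (forall x, x \in S' -> h x = 0) ->
       collinear S') ->
    ~ collinear S -> exists2 x, x \in S & h x != 0.
  move=> Hh nS; apply: contrapT => Hn; apply/nS/Hh => x xS.
  by apply/eqP; apply: contra_notT Hn => hx; exists x.
have off_line' (S S' : {fset 'rV[R]_2}) (h : 'rV[R]_2 -> R) :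
    (forall x, x \in S -> h x = 0) ->
    (exists2 x, x \in (S `|` S')%fset & h x != 0) ->
    exists2 x, x \in S' & h x != 0.
  move=> HS [x + hx]; rewrite inE => /orP[/HS hx0|xS']; last by exists x.
  by rewrite hx0 eqxx in hx.
have PE : (A `|` B = (A1 `|` B1) `|` (A2 `|` B2))%fset.
  by rewrite EA EB fsetUACA.
have u1' x : x \in (A1 `|` B1)%fset -> - u x < 0.
  by move=> /u1; rewrite oppr_lt0.
have u2' x : x \in (A2 `|` B2)%fset -> 0 < - u x.
  by move=> /u2; rewrite oppr_gt0.
(* As soon as one part is non-collinear the count reaches [n + 2]; only two collinear parts give
   [n + 1]. *)
have [c1|n1] := EM (collinear (A1 `|` B1)%fset); last first.
  rewrite EA EB.
  have [c2|n2] := EM (collinear (A2 `|` B2)%fset); last first.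
    have [E [sE nE kE _]] := has_plane_subgraph_sep au u1 u2 (IH1 n1) (IH2 n2).
    by exists E; split=> //; lia.
  have [h [k [ah _ h2 _ hcol]]] := collinear_affine c2.
  have := fan au ah u1 u2 h2 (off_line _ _ hcol n1) (IH1 n1) K2.
  by apply: has_plane_subgraph_le; rewrite cA2 cB2; lia.
have [h1 [k1 [ah1 _ h11 _ h1col]]] := collinear_affine c1.
have [c2|n2] := EM (collinear (A2 `|` B2)%fset); last first.
  rewrite EA EB (fsetUC A1) (fsetUC B1).
  have := fan (affine_opp au) ah1 u2' u1' h11
    (off_line _ _ h1col n2) (IH2 n2) K1.
  by apply: has_plane_subgraph_le; rewrite cA1 cB1; lia.
have [h2 [k2 [ah2 ak2 h22 k2_inj h2col]]] := collinear_affine c2.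
(* Otherwise both parts would lie on [h1 = 0], and the whole set would be collinear. *)
have h12 : exists2 x, x \in (A2 `|` B2)%fset & h1 x != 0.
  by apply: off_line' h11 _; rewrite -PE; exact: off_line.
have h21 : exists2 x, x \in (A1 `|` B1)%fset & h2 x != 0.
  by apply: off_line' h22 _; rewrite fsetUC -PE; exact: off_line.
have := two_lines (affine_opp au) ah1 ah2 ak2 d1 d2 cA1 cB1 cA2 cB2
  m1_gt0 m2_gt0 u1' u2' h11 h12 h22 h21 k2_inj.
by rewrite -EA -EB -En.
Qed.
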